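(* Let $u\in W$ be the weak solution of the primal problem $a(u,\varphi)=0$ for all $\varphi\in V$, and let $z\in V$ be the weak solution of the adjoint problem, with all spaces, forms, functionals and standing assumptions (consistency, adjoint consistency, linearizations) as given in the context. Let $k\ge 1$ and let $u_h^{(k-1)}\in W_h$ be the previous iterate. Let $u_h^{(k)}\in W_h$ and $z_h^{(k)}\in V_h$ be the numerical approximations given by $$a_h^{\mathrm L}(u_h^{(k-1)},u_h^{(k)},\varphi_h)=\tilde a_h(u_h^{(k-1)},\varphi_h)\quad\forall \varphi_h\in V_h,$$ $$a_h^{\mathrm L}(u_h^{(k-1)},\psi_h,z_h^{(k)})=J_h^{\mathrm L}(u_h^{(k-1)},\psi_h)\quad\forall \psi_h\in W_h,$$ and let $\tilde u^{(k)}\in W(h)$ and $\tilde z^{(k)}\in V(h)$ be solutions of the auxiliary problems $$a_h^{\mathrm L}(u_h^{(k-1)},\tilde u^{(k)},\varphi)=\tilde a_h(u_h^{(k-1)},\varphi)\quad\forall\varphi\in V(h),$$ $$a_h^{\mathrm L}(u_h^{(k-1)},\psi,\tilde z^{(k)})=J_h^{\mathrm L}(u_h^{(k-1)},\psi)\quad\forall\psi\in W(h).$$ Then the error of the quantity of interest satisfies $$J(u)-J_h(u_h^{(k)})=e_h^{\mathrm S}+e_h^{\mathrm A}+e_h^{\mathrm L}+e_h^{\mathrm J}+e_h^{\mathrm R},$$ where $$e_h^{\mathrm S}=\tfrac12\Big(r_h(u_h^{(k-1)},u_h^{(k)})(\tilde z^{(k)}-z_h^{(k)})+r_h^*(u_h^{(k-1)},z_h^{(k)})(\tilde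 u^{(k)}-u_h^{(k)})\Big),$$ $$e_h^{\mathrm A}=r_h(u_h^{(k-1)},u_h^{(k)})(z_h^{(k)}),$$ $$e_h^{\mathrm L}=a_h^{\mathrm L}(u,u-u_h^{(k)},z)-a_h^{\mathrm L}(u_h^{(k-1)},\tilde u^{(k)}-u_h^{(k)},\tilde z^{(k)}),$$ $$e_h^{\mathrm J}=J_h^{\mathrm L}(u,u_h^{(k)})-J_h^{\mathrm L}(u_h^{(k)},u_h^{(k)}),\qquad e_h^{\mathrm R}=\tilde J_h(u)-\tilde J_h(u_h^{(k)}).$$ Moreover, the linearization part of the error can be written by the alternative formula $$e_h^{\mathrm L}+e_h^{\mathrm J}=e_h^{\mathrm{A\star}}+e_h^{\mathrm{J\star}},$$ where $$e_h^{\mathrm{A\star}}=a_h^{\mathrm L}(u,u,z-z_h^{(k)})-a_h^{\mathrm L}(u_h^{(k-1)},\tilde u^{(k)},\tilde z^{(k)}-z_h^{(k)}),$$ $$e_h^{\mathrm{J\star}}=\tilde a_h(u,z_h^{(k)})-\tilde a_h(u_h^{(k-1)},z_h^{(k)})+J_h^{\mathrm L}(u_h^{(k-1)},u_h^{(k)})-J_h^{\mathrm L}(u_h^{(k)},u_h^{(k)}).$$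
   Context: Spaces: $V,W$ are real vector spaces of functions; $V_h,W_h$ are finite-dimensional (piecewise polynomial) spaces; $V(h),W(h)$ are real vector spaces of functions with $V\subset V(h)$, $V_h\subset V(h)$, $W\subset W(h)$, $W_h\subset W(h)$. Primal problem: $a:W\times V\to\mathbb R$ is a semilinear form (possibly nonlinear in its first argument, linear in its second), and $u\in W$ satisfies $a(u,\varphi)=0$ for all $\varphi\in V$. Discretization: $a_h:W(h)\times V(h)\to\mathbb R$ is a semilinear form that is consistent, i.e. $a_h(u,\varphi)=0$ for all $\varphi\in V(h)$. Linearization of $a_h$: there are forms $a_h^{\mathrm L}:W(h)\times W(h)\times V(h)\to\mathbb R$, linear in its second and third arguments, and $\tilde a_h:W(h)\times V(h)\to\mathbb R$, linear in its second argument, such that $$a_h(w,\varphi)=a_h^{\mathrm L}(w,w,\varphi)-\tilde a_h(w,\varphi)\quad\forall w\in W(h),\ \forall\varphi\in V(h).$$ Quantity of interest: $J:W(h)\to\mathbb R$ is a possibly nonlinear functional, and $J_h:W(h)\to\mathbb R$ is a modified functional consistent with $J$ in the sense that $J_h(u)=J(u)$ for the weak solution $u$. There are $J_h^{\mathrm L}:W(h)\times W(h)\to\mathbb R$, linear in its second argument, and $\tilde J_h:W(h)\to\mathbb R$ such that $$J_h(w)=J_h^{\mathrm L}(w,w)+\tilde J_h(w)\quad\forall w\in W(h).$$ Adjoint consistency: the weak solution $z\in V$ of the adjoint problem satisfies, together with $u$, $$a_h^{\mathrm L}(u,\psi,z)=J_h^{\mathrm L}(u,\psi)\quad\forall\psi\in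 W(h).$$ (This identity is the only property of $z$ that is specified.) Residuals: for $v,w,\psi\in W(h)$ and $\varphi,y\in V(h)$, $$r_h(v,w)(\varphi):=-a_h^{\mathrm L}(v,w,\varphi)+\tilde a_h(v,\varphi),\qquad r_h^*(v,y)(\psi):=J_h^{\mathrm L}(v,\psi)-a_h^{\mathrm L}(v,\psi,y).$$ The iteration starts from an arbitrary $u_h^{(0)}\in W_h$; the solutions $u_h^{(k)}$, $z_h^{(k)}$, $\tilde u^{(k)}$, $\tilde z^{(k)}$ of the respective problems are assumed to exist. *)

(* Defs.v *)
From HB Require Import structures.
From mathcomp Require Import all_boot all_order all_algebra.
From mathcomp Require Import reals.

Set Implicit Arguments.
Unset Strict Implicit.
Unset Printing Implicit Defensive.

Import Order.TTheory GRing.Theory Num.Theory.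
Local Open Scope ring_scope.

(* A semilinear form WH x VH -> R (linear in its last argument only) is a
   function from WH to linear functionals on VH; the linearized forms, which
   are moreover linear in the middle argument, are functions from WH to
   bilinear forms. *)

Section ErrorTerms.
Variables (R : realType) (WH VH : lmodType R).
Variables (aL : WH -> {bilinear WH -> VH -> R | *%R & *%R})
          (at_ : WH -> {scalar VH}).
Variables (JL : WH -> {scalar WH}) (Jt : WH -> R).

Definition residual (v w : WH) (phi : VH) : R :=
  - aL v w phi + at_ v phi.

Definition adjoint_residual (v : WH) (y : VH) (psi : WH) : R :=
  JL v psi - aL v psi y.

(* In the error terms below, [u] and [z] are the exact primal and adjoint
   solutions, [u0] is the previous iterate, [uh] and [zh] are the current
   discrete solutions, and [ut] and [zt] solve the auxiliary problems. *)

Definition errS (u0 uh ut : WH) (zh zt : VH) : R :=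
  2^-1 * (residual u0 uh (zt - zh) + adjoint_residual u0 zh (ut - uh)).

Definition errA (u0 uh : WH) (zh : VH) : R := residual u0 uh zh.

Definition errL (u u0 uh ut : WH) (z zt : VH) : R :=
  aL u (u - uh) z - aL u0 (ut - uh) zt.

Definition errJ (u uh : WH) : R := JL u uh - JL uh uh.

Definition errR (u uh : WH) : R := Jt u - Jt uh.

Definition errAstar (u u0 ut : WH) (z zh zt : VH) : R :=
  aL u u (z - zh) - aL u0 ut (zt - zh).

Definition errJstar (u u0 uh : WH) (zh : VH) : R :=
  at_ u zh - at_ u0 zh + JL u0 uh - JL uh uh.

End ErrorTerms.

(* Main.v *)
Require Import Defs.
From HB Require Import structures.
From mathcomp Require Import all_boot all_order all_algebra.
From mathcomp Require Import reals ring.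

(** The auxiliary solutions turn both residuals into values of a single bilinear
form, the linearization taken at the previous iterate: testing against the
full space, the primal residual of [w] is the form at ([ut - w], _) and the
adjoint residual of [y] is the form at (_, [zt - y]) ([residualE],
[adjoint_residualE]).  Hence the two halves of the symmetric term [errS]
coincide, and adding [errA] to it replaces [zt - zh] by [zt]
([errS_errA]).  The result is exactly the term subtracted in [errL], so
[errS + errA + errL] is the exact adjoint form at [u - uh], which adjoint
consistency converts into [JL u (u - uh)] ([errS_errA_errL]).  The remaining
terms [errJ] and [errR] then telescope to the difference of the two functional
values.

The alternative formula for [errL + errJ] comes from expanding by bilinearity:
the two adjoint identities replace the form at [uh] by values of [JL], and the
insertion of [zh] in the last argument is balanced by the values of [at_] at
[zh], thanks to primal consistency at [u] and the auxiliary primal problem at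
[u0] ([errL_errJ]). *)

Set Implicit Arguments.
Unset Strict Implicit.
Unset Printing Implicit Defensive.

Import Order.TTheory GRing.Theory Num.Theory.
Local Open Scope ring_scope.

Section ErrorRepresentation.
Variables (R : realType) (WH VH : lmodType R).
Variables (aL : WH -> {bilinear WH -> VH -> R | *%R & *%R})
          (at_ : WH -> {scalar VH}) (JL : WH -> {scalar WH}).
Implicit Types (u uh ut w psi : WH) (z zh zt phi y : VH).

Lemma residualE u0 ut w phi :
  (forall phi, aL u0 ut phi = at_ u0 phi) ->
  residual aL at_ u0 w phi = aL u0 (ut - w) phi.
Proof. by move=> ut_sol; rewrite /residual -ut_sol linearBl addrC. Qed.

Lemma adjoint_residualE u0 zt y psi :
  (forall psi, aL u0 psi zt = JL u0 psi) ->
  adjoint_residual aL JL u0 y psi = aL u0 psi (zt - y).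
Proof. by move=> zt_sol; rewrite /adjoint_residual -zt_sol linearBr. Qed.

(** Both residuals in [errS] equal the form at ([ut - uh], [zt - zh]), which
cancels the factor one half; [errA] supplies the missing part at [zh]. *)
Lemma errS_errA u0 uh ut zh zt :
  (forall phi, aL u0 ut phi = at_ u0 phi) ->
  (forall psi, aL u0 psi zt = JL u0 psi) ->
  errS aL at_ JL u0 uh ut zh zt + errA aL at_ u0 uh zh = aL u0 (ut - uh) zt.
Proof.
move=> ut_sol zt_sol.
rewrite /errS /errA !(residualE _ _ ut_sol) (adjoint_residualE _ _ zt_sol).
by rewrite linearBr; field.
Qed.

(** The value of the form at [u0] left over by [errS_errA] is what [errL]
subtracts, so no dependence on the previous iterate survives. *)
Lemma errS_errA_errL u u0 uh ut z zh zt :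
  (forall psi, aL u psi z = JL u psi) ->
  (forall phi, aL u0 ut phi = at_ u0 phi) ->
  (forall psi, aL u0 psi zt = JL u0 psi) ->
  errS aL at_ JL u0 uh ut zh zt + errA aL at_ u0 uh zh
    + errL aL u u0 uh ut z zt = JL u (u - uh).
Proof.
move=> z_sol ut_sol zt_sol.
by rewrite (errS_errA _ _ ut_sol zt_sol) /errL z_sol addrC subrK.
Qed.

(** The terms at [uh] in [errL] are values of [JL] by the two adjoint
identities.  The ones that [errAstar] has at [zh] are values of [at_] by the
two primal identities, and [errJstar] takes them out again. *)
Lemma errL_errJ u u0 uh ut z zh zt :
  (forall phi, aL u u phi = at_ u phi) ->
  (forall psi, aL u psi z = JL u psi) ->
  (forall phi, aL u0 ut phi = at_ u0 phi) ->
  (forall psi, aL u0 psi zt = JL u0 psi) ->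
  errL aL u u0 uh ut z zt + errJ JL u uh
    = errAstar aL u u0 ut z zh zt + errJstar at_ JL u u0 uh zh.
Proof.
move=> u_sol z_sol ut_sol zt_sol.
rewrite /errL /errJ /errAstar /errJstar -u_sol -ut_sol -z_sol -zt_sol.
by rewrite !linearBl !linearBr; ring.
Qed.

End ErrorRepresentation.

Theorem theorem2p2 (R : realType)
  (* the spaces W(h), V(h) and their subspaces W, V, W_h, V_h *)
  (WH VH : lmodType R)
  (PW : pred WH) (W : subLmodType PW)
  (PV : pred VH) (V : subLmodType PV)
  (PWh : pred WH) (Wh : subLmodType PWh) (dimWh : nat)
  (Wh_fin_dim : Vector.axiom dimWh Wh)
  (PVh : pred VH) (Vh : subLmodType PVh) (dimVh : nat)
  (Vh_fin_dim : Vector.axiom dimVh Vh)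
  (* the primal problem *)
  (a : W -> {scalar V})
  (u : W) (u_sol : forall phi : V, a u phi = 0)
  (* the consistent discretization and its linearization *)
  (ah : WH -> {scalar VH})
  (ah_consistent : forall phi : VH, ah (\val u) phi = 0)
  (aL : WH -> {bilinear WH -> VH -> R | *%R & *%R})
  (at_ : WH -> {scalar VH})
  (ah_lin : forall (w : WH) (phi : VH), ah w phi = aL w w phi - at_ w phi)
  (* the quantity of interest *)
  (J Jh : WH -> R)
  (Jh_consistent : Jh (\val u) = J (\val u))
  (JL : WH -> {scalar WH}) (Jt : WH -> R)
  (Jh_lin : forall w : WH, Jh w = JL w w + Jt w)
  (* the adjoint solution and adjoint consistency *)
  (z : V)
  (adj_consistent : forall psi : WH, aL (\val u) psi (\val z) = JL (\val u) psi)
  (* the k-th step of the iteration *)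
  (uh : nat -> Wh) (zh : nat -> Vh) (ut : nat -> WH) (zt : nat -> VH)
  (k : nat) (k_ge1 : (1 <= k)%N)
  (uh_sol : forall phi : Vh,
     aL (\val (uh k.-1)) (\val (uh k)) (\val phi)
     = at_ (\val (uh k.-1)) (\val phi))
  (zh_sol : forall psi : Wh,
     aL (\val (uh k.-1)) (\val psi) (\val (zh k))
     = JL (\val (uh k.-1)) (\val psi))
  (ut_sol : forall phi : VH,
     aL (\val (uh k.-1)) (ut k) phi = at_ (\val (uh k.-1)) phi)
  (zt_sol : forall psi : WH,
     aL (\val (uh k.-1)) psi (zt k) = JL (\val (uh k.-1)) psi) :
  let u_ := \val u in
  let z_ := \val z in
  let u0 := \val (uh k.-1) in
  let uk := \val (uh k) in
  let zk := \val (zh k) in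
  J u_ - Jh uk
    = errS aL at_ JL u0 uk (ut k) zk (zt k)
      + errA aL at_ u0 uk zk
      + errL aL u_ u0 uk (ut k) z_ (zt k)
      + errJ JL u_ uk
      + errR Jt u_ uk
  /\ errL aL u_ u0 uk (ut k) z_ (zt k) + errJ JL u_ uk
     = errAstar aL u_ u0 (ut k) z_ zk (zt k)
       + errJstar at_ JL u_ u0 uk zk.
Proof.
move=> u_ z_ u0 uk zk; split.
  rewrite (errS_errA_errL _ _ adj_consistent ut_sol zt_sol).
  by rewrite -Jh_consistent !Jh_lin /errJ /errR linearB; ring.
apply: errL_errJ => // phi.
by apply/eqP; rewrite -subr_eq0 -ah_lin ah_consistent.
Qed.
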